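(* Let $\lambda>0$ and let $P$ be a nearest-neighbour jump distribution on $\mathbb{Z}$. Let $n\ge1$, let $V_n=(-n/2,n/2]\cap\mathbb{Z}$, let $\eta:V_n\to\mathbb{N}$ be a fixed deterministic initial configuration on $V_n$ with only active particles, and let $a,b\in\mathbb{Z}$ be such that $W=\{a,\dots,b\}\supset V_n$. Starting from the initial configuration $\eta$ and performing legal topplings in $V_n$ and acceptable topplings in $W\setminus V_n$ until the resulting configuration is stable in $V_n$ and empty in $W\setminus V_n$, denote by $M_n^W$ the number of particles which jump out of $W$. Let $M_n$ be the number of particles which jump out of $V_n$ during the stabilization of $\eta$ in $V_n$, with particles being killed upon leaving $V_n$. Then $M_n$ stochastically dominates $M_n^W$.
   Context: $\mathbb{N}=\{0,1,2,\dots\}$. The model is Activated Random Walks on $\mathbb{Z}$ with sleep rate $\lambda$ and jump distribution $P$. A jump distribution on $\mathbb{Z}$ is a map $P:\mathbb{Z}\times\mathbb{Z}\to[0,1]$ with $\sum_y P(x,y)=1$ for all $x$; it is nearest-neighbour if $P(x,y)=0$ unless $|x-y|=1$. Configurations. A configuration is a function $\eta:\mathbb{Z}\to\mathbb{N}\cup\{\mathfrak{s}\}$: $\eta(x)=k\in\mathbb{N}$ means $k$ active particles at $x$, and $\eta(x)=\mathfrak{s}$ means exactly one sleeping particle at $x$. A site is stable if it is empty or contains a sleeping particle; a configuration is stable in $V$ if all sites of $V$ are stable. Here $\eta:V_n\to\mathbb{N}$ is extended by $0$ outside $V_n$. Instructions and topplings. Let $\tau=(\tau_{x,i})_{x\in\mathbb{Z},i\ge1}$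 be an array of independent instructions, where $\tau_{x,i}$ is a sleep instruction with probability $\lambda/(1+\lambda)$ and a jump instruction to $y$ with probability $P(x,y)/(1+\lambda)$. Toppling $x$ is legal if $x$ contains at least one active particle, and acceptable if $x$ contains at least one particle (active or sleeping). Toppling $x$ means using the first unused instruction at $x$, after first waking up the particle at $x$ if it is sleeping: a sleep instruction makes the particle at $x$ fall asleep if it is alone (nothing happens if there are at least two particles at $x$); a jump instruction to $y$ moves one particle from $x$ to $y$, and if there is a sleeping particle at $y$ it becomes active. The variable $M_n$. Starting from $\eta$, perform legal topplings of sites of $V_n$ only, until the configuration is stable in $V_n$ (the final configuration does not depend on the order of topplings). $M_n$ is the number of particles that have jumped out of $V_n$; such particles never move again. The variable $M_n^W$. Only sites of $W$ are toppled (particles outside $W$ never move again). In other words, $M_n^W$ is the number of particles leaving $W$ when $W$ is stabilized by legal topplings using the array obtained from $\tau$ by deleting all sleep instructions at the sites of $W\setminus V_n$. Stochastic domination means that $\mathbb{P}(M_n^W\ge k)\le\mathbb{P}(M_n\ge k)$ for every $k\in\mathbb{N}$, both systems being started from $\eta$. *)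

(* Defs.v *)
From mathcomp Require Import all_boot all_order all_algebra.
From mathcomp Require Import all_classical all_reals all_analysis.

Set Implicit Arguments.
Unset Strict Implicit.
Unset Printing Implicit Defensive.

Import Order.TTheory GRing.Theory Num.Theory.
Local Open Scope classical_set_scope.
Local Open Scope ring_scope.

(* N together with one extra value for a single sleeping particle. *)
Inductive site_state := Active of nat | Sleeping.

Definition config := int -> site_state.

Inductive instruction := Sleep | Jump of int.

Definition is_active (s : site_state) : bool :=
  if s is Active k then (0 < k)%N else false.

Definition is_empty (s : site_state) : bool :=
  if s is Active k then k == 0%N else false.

Definition is_stable (s : site_state) : bool :=
  if s is Active k then k == 0%N else true.

Definition wake_up (s : site_state) : site_state :=
  if s is Sleeping then Active 1 else s.

Definition fall_asleep (s : site_state) : site_state :=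
  if s is Active 1 then Sleeping else s.

(* The active particle that arrives wakes up a sleeping one. *)
Definition add_particle (s : site_state) : site_state :=
  if s is Active k then Active k.+1 else Active 2.

(* Only used at sites holding active particles only. *)
Definition remove_particle (s : site_state) : site_state :=
  if s is Active k then Active k.-1 else s.

Definition apply_instruction (x : int) (i : instruction) (c : config) : config :=
  match i with
  | Sleep => fun u => if u == x then fall_asleep (wake_up (c u)) else c u
  | Jump y => fun u =>
      let s := if u == x then remove_particle (wake_up (c u)) else c u in
      if u == y then add_particle s else s
  end.

(* [used x] is the number of instructions already used at [x], and [escaped]
   the number of particles that have jumped out of the region. *)
Record state := State { cfg : config; used : int -> nat; escaped : nat }.

Definition init_state (c : config) : state := State c (fun=> 0%N) 0%N.

Definition jumps_out (W : pred int) (i : instruction) : bool :=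
  if i is Jump y then ~~ W y else false.

(* The instructions at each site are numbered from 0. *)
Definition topple (W : pred int) (t : int -> nat -> instruction)
    (s : state) (x : int) : state :=
  let i := t x (used s x) in
  State (apply_instruction x i (cfg s))
        (fun u => if u == x then (used s u).+1 else used s u)
        (escaped s + jumps_out W i)%N.

(* Legal topplings in V, acceptable topplings in W \ V, none outside W. *)
Definition can_topple (V W : pred int) (s : state) (x : int) : bool :=
  W x && (if V x then is_active (cfg s x) else ~~ is_empty (cfg s x)).

Fixpoint allowed (V W : pred int) (t : int -> nat -> instruction)
    (s : state) (xs : seq int) : bool :=
  if xs is x :: xs' then
    can_topple V W s x && allowed V W t (topple W t s x) xs'
  else true.

Definition run (W : pred int) (t : int -> nat -> instruction)
    (s : state) (xs : seq int) : state := foldl (topple W t) s xs.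

Definition stabilized (V W : pred int) (s : state) : Prop :=
  (forall x, V x -> is_stable (cfg s x)) /\
  (forall x, W x -> ~~ V x -> is_empty (cfg s x)).

(* Number of particles that jump out of W when one performs legal topplings in
   V and acceptable topplings in W \ V. As soon as some finite sequence of such
   topplings ends in a configuration which is stable in V and empty in W \ V,
   this is the number of particles that have jumped out at the end of that
   sequence, whichever it is (num_escaped_stabilized below). The supremum also
   gives a meaning to the number of particles that jump out when the
   procedure goes on forever. *)
Definition num_escaped (R : realType) (V W : pred int)
    (t : int -> nat -> instruction) (c : config) : \bar R :=
  ereal_sup [set (escaped (run W t (init_state c) xs))%:R%:E
            | xs in [set xs | allowed V W t (init_state c) xs]].

Lemma can_toppleN V W s x : stabilized V W s -> ~~ can_topple V W s x.
Proof.
move=> [sV sW]; rewrite /can_topple; apply/negP => /andP[Wx].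
case: ifPn => Vx; last by rewrite (sW x Wx Vx).
by move: (sV x Vx); rewrite /is_stable /is_active; case: (cfg s x) => // -[].
Qed.

Lemma can_topple_occupied V W s x :
  can_topple V W s x -> ~~ is_empty (cfg s x).
Proof.
move=> /andP[_]; case: ifP => // _.
by rewrite /is_active /is_empty; case: (cfg s x) => // -[].
Qed.

Lemma can_topple_topple V W t s x y : x != y ->
  can_topple V W s x -> can_topple V W (topple W t s y) x.
Proof.
move=> xy; rewrite /can_topple => /andP[-> /=].
rewrite /apply_instruction; case: (t y _) => [|z]; rewrite (negPf xy) //.
by case: ifP => _; case: ifP => _; case: (cfg s x).
Qed.

Lemma topple_comm W t s x y : x != y ->
  ~~ is_empty (cfg s x) -> ~~ is_empty (cfg s y) ->
  topple W t (topple W t s x) y = topple W t (topple W t s y) x.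
Proof.
move=> xy sx sy; rewrite /topple /= (negPf xy) eq_sym (negPf xy).
congr State; last 2 first.
- apply/funext => u; case: (eqVneq u x) => [->|//].
  by rewrite (negPf xy).
- by rewrite addnAC.
apply/funext => u; rewrite /apply_instruction.
have {}sx : u == x -> ~~ is_empty (cfg s u) by move=> /eqP ->.
have {}sy : u == y -> ~~ is_empty (cfg s u) by move=> /eqP ->.
have {}xy : ~~ ((u == x) && (u == y)).
  by apply: contra xy => /andP[/eqP <- /eqP <-].
by case: (t x _) => [|z]; case: (t y _) => [|z'] /=;
  try case: (u == z); try case: (u == z');
  move: (cfg s u) (u == x) (u == y) sx sy xy;
  move=> [[|[|k]]|] [] [] // sx sy _; (have := sx isT) || (have := sy isT).
Qed.

Lemma can_topple_run V W t xs s x : x \notin xs ->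
  can_topple V W s x -> can_topple V W (run W t s xs) x.
Proof.
elim: xs s => [//|y xs IH] s /=; rewrite inE negb_or => /andP[xy xxs] sx.
exact/IH/can_topple_topple.
Qed.

Lemma allowed_move_front V W t x ys zs s : x \notin ys -> can_topple V W s x ->
  allowed V W t s (ys ++ x :: zs) ->
  allowed V W t (topple W t s x) (ys ++ zs) /\
  run W t s (ys ++ x :: zs) = run W t (topple W t s x) (ys ++ zs).
Proof.
elim: ys s => [|y ys IH] s /=; first by move=> _ _ /andP[].
rewrite inE negb_or => /andP[xy xys] sx /andP[sy al].
have [al' runE] := IH _ xys (can_topple_topple t xy sx) al.
have yx : y != x by rewrite eq_sym.
rewrite runE (topple_comm _ _ yx) ?(can_topple_occupied sx)
  ?(can_topple_occupied sy) //.
split=> //; rewrite can_topple_topple //=.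
by rewrite (topple_comm _ _ xy) ?(can_topple_occupied sx)
  ?(can_topple_occupied sy).
Qed.

Lemma escaped_run W t s xs : (escaped s <= escaped (run W t s xs))%N.
Proof.
elim: xs s => [//|x xs IH] s /=.
by apply: leq_trans (IH _); rewrite leq_addr.
Qed.

Lemma escaped_le V W t xs ys s :
  allowed V W t s xs -> allowed V W t s ys ->
  stabilized V W (run W t s ys) ->
  (escaped (run W t s xs) <= escaped (run W t s ys))%N.
Proof.
elim: xs ys s => [|x xs IH] ys s /=; first by move=> _ _ _; exact: escaped_run.
move=> /andP[sx axs] ays st.
have xys : x \in ys.
  by apply/negPn/negP => /(can_topple_run t)/(_ sx); exact/negP/can_toppleN.
have [ys1 ys2 x1] : exists2 ys1, x \notin ys1 & exists ys2, ys = ys1 ++ x :: ys2.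
  exists (take (index x ys) ys); last first.
    exists (drop (index x ys).+1 ys).
    by rewrite -[in LHS](cat_take_drop (index x ys) ys)
      (drop_nth x) ?index_mem // nth_index.
  by apply/negP => /index_ltn; rewrite ltnn.
move: x1 => [zs ysE]; subst ys.
have [al runE] := allowed_move_front ys2 sx ays.
by rewrite runE in st *; exact: IH.
Qed.

Lemma num_escaped_stabilized (R : realType) V W t c ys :
  allowed V W t (init_state c) ys ->
  stabilized V W (run W t (init_state c) ys) ->
  num_escaped R V W t c = (escaped (run W t (init_state c) ys))%:R%:E.
Proof.
move=> ays st; apply/eqP; rewrite eq_le; apply/andP; split.
  apply: ge_ereal_sup => _ [xs axs <-].
  by rewrite lee_fin ler_nat; exact: (escaped_le axs ays st).
by apply: ereal_sup_ubound; exists ys.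
Qed.

Definition jump_distribution (R : realType) (P : int -> int -> R) : Prop :=
  (forall x y, 0 <= P x y <= 1) /\
  (forall x, \esum_(y in [set: int]) (P x y)%:E = 1%E).

Definition nearest_neighbour (R : realType) (P : int -> int -> R) : Prop :=
  forall x y, `|x - y| != 1 -> P x y = 0.

Definition mutually_independent (R : realType) (d : measure_display)
    (T : measurableType d) (Pr : probability T R) (I : eqType) (E : Type)
    (X : I -> T -> E) : Prop :=
  forall (r : seq I) (A : I -> set E), uniq r ->
    Pr (\bigcap_(i in [set` r]) (X i @^-1` A i)) =
    (\prod_(i <- r) Pr (X i @^-1` A i))%E.

(* The countable type of instructions carries the discrete sigma-algebra. *)
Definition instruction_array (R : realType) (d : measure_display)
    (T : measurableType d) (Pr : probability T R) (lambda : R)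
    (P : int -> int -> R) (tau : int -> nat -> T -> instruction) : Prop :=
  [/\ forall x i (A : set instruction), measurable (tau x i @^-1` A),
      mutually_independent Pr (fun xi : int * nat => tau xi.1 xi.2),
      forall x i, Pr (tau x i @^-1` [set Sleep]) = (lambda / (1 + lambda))%:E
    & forall x i y,
        Pr (tau x i @^-1` [set Jump y]) = (P x y / (1 + lambda))%:E].

(* (-n/2, n/2] *)
Definition box (n : nat) : pred int :=
  fun x => (- n%:Z < 2 * x) && (2 * x <= n%:Z).

Definition int_segment (a b : int) : pred int := fun x => (a <= x) && (x <= b).

(* eta on V and nothing outside V; the values of eta outside V are irrelevant. *)
Definition active_config (V : pred int) (eta : int -> nat) : config :=
  fun x => Active (if V x then eta x else 0%N).

(* Main.v *)
(** Killing a particle when it leaves [V] amounts to replacing every jump out of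
[V] by a jump to a site [o] outside [W]. These replacements are made one entry
[(x, i)] of the array at a time, so it suffices to see that, if this entry is
[Jump y], then the probability [u y] that at least [k] particles escape is
maximal for [y = o].

The function [u] is subharmonic on [W] for the walk driven by the instructions.
Indeed, let [m] be the least number of entries of [z] with which the entry
[(x, i)] can be reached. By minimality [z] is not asleep when the particle lands
there, so that toppling [z] is legal and moves the particle one step further,
up to putting it to sleep, which can only decrease what escapes. The instruction
used is the entry [(z, m)], independent of everything else, and deleting it does
not change the law of the array.

By the maximum principle, if [u] took a value greater than [u o], its maximum
would be attained on a set of sites that no instruction leaves; but a particle
landing in such a set never makes any other particle escape. *)

Require Import Defs.
From HB Require Import structures.
From mathcomp Require Import all_boot all_order all_algebra.
From mathcomp Require Import all_classical all_reals all_analysis.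

Set Implicit Arguments.
Unset Strict Implicit.
Unset Printing Implicit Defensive.

Import Order.TTheory GRing.Theory Num.Theory.
Local Open Scope classical_set_scope.
Local Open Scope ring_scope.

(** * Runs of topplings: locality, commutation and monotonicity *)

Notation array := (int -> nat -> instruction).

(** A finite witness replaces the supremum in [num_escaped], which makes the events countable unions
    over toppling sequences. *)
Definition reach_from (V W : pred int) (t : array) (s : state) (k : nat) : Prop :=
  exists2 xs, allowed V W t s xs & (k <= escaped (run W t s xs))%N.

Definition reach V W t c k := reach_from V W t (init_state c) k.

Lemma num_escapedP (R : realType) V W t c k :
  (k%:R%:E <= num_escaped R V W t c)%E <-> reach V W t c k.
Proof.
split=> [|[xs axs kxs]]; last first.
  apply: le_trans (_ : ((escaped (run W t (init_state c) xs))%:R%:E <= _)%E).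
    by rewrite lee_fin ler_nat.
  by apply: ereal_sup_ubound; exists xs.
case: k => [_|k kM]; first by exists [::].
apply: contrapT => nreach.
suff : (num_escaped R V W t c <= k%:R%:E)%E.
  by move=> /(le_trans kM); rewrite lee_fin ler_nat ltnn.
apply: ge_ereal_sup => _ [xs axs <-]; rewrite lee_fin ler_nat leqNgt.
by apply/negP => kxs; apply: nreach; exists xs.
Qed.

Lemma run_cat W t s xs ys : run W t s (xs ++ ys) = run W t (run W t s xs) ys.
Proof. exact: foldl_cat. Qed.

Lemma run_rcons W t s xs x : run W t s (rcons xs x) = topple W t (run W t s xs) x.
Proof. by rewrite -cats1 run_cat. Qed.

Lemma allowed_cat V W t s xs ys :
  allowed V W t s (xs ++ ys) = allowed V W t s xs && allowed V W t (run W t s xs) ys.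
Proof. by elim: xs s => //= x xs IH s; rewrite IH andbA. Qed.

Lemma allowed_rcons V W t s xs x :
  allowed V W t s (rcons xs x) = allowed V W t s xs && can_topple V W (run W t s xs) x.
Proof. by rewrite -cats1 allowed_cat /= andbT. Qed.

Lemma used_run W t s xs y : (used s y <= used (run W t s xs) y)%N.
Proof.
elim: xs s => //= x xs IH s; apply: leq_trans (IH _) => /=.
by case: ifP.
Qed.

Lemma used_run_size W t s xs y : (used (run W t s xs) y <= used s y + size xs)%N.
Proof.
elim: xs s => [|x xs IH] s /=; first by rewrite addn0.
by apply: leq_trans (IH _) _ => /=; case: ifP; rewrite addnS ?addSn.
Qed.

(** A run reads only entries below its final counters. Every argument about finite dependence, or
    about entries not yet reached, comes down to this. *)
Lemma eq_run V W t t' s xs :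
  (forall y n, (n < used (run W t s xs) y)%N -> t y n = t' y n) ->
  run W t' s xs = run W t s xs /\ allowed V W t' s xs = allowed V W t s xs.
Proof.
elim: xs s => [//|x xs IH] s /= tt'.
have tx : t x (used s x) = t' x (used s x).
  by apply: tt'; apply: leq_trans (used_run _ _ _ _ _); rewrite /= eqxx.
have -> : topple W t' s x = topple W t s x by rewrite /topple tx.
by have [-> ->] := IH _ tt'.
Qed.

Lemma run_topple_notin V W t s x ys :
  x \notin ys -> can_topple V W s x -> allowed V W t s ys ->
  allowed V W t (topple W t s x) ys /\
  run W t (topple W t s x) ys = topple W t (run W t s ys) x.
Proof.
elim: ys s => [//|y ys IH] s; rewrite inE negb_or => /andP[xy xys] sx /= /andP[sy ays].
have yx : y != x by rewrite eq_sym.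
rewrite can_topple_topple //= (topple_comm _ _ xy) ?(can_topple_occupied sx)
  ?(can_topple_occupied sy) //.
exact: IH xys (can_topple_topple t xy sx) ays.
Qed.

(** Topplings commute: if the witness topples [x], that toppling moves to the front; if not, [x]
    stays topplable throughout, and toppling it after the witness takes no escaped particle back. *)
Lemma reach_from_topple V W t s x k : can_topple V W s x ->
  reach_from V W t s k -> reach_from V W t (topple W t s x) k.
Proof.
move=> sx [ys ays kys]; have [xys|xys] := boolP (x \in ys).
  have [ys1 x1 [ys2 ysE]] : exists2 ys1, x \notin ys1 & exists ys2, ys = ys1 ++ x :: ys2.
    exists (take (index x ys) ys); last first.
      exists (drop (index x ys).+1 ys).
      by rewrite -[in LHS](cat_take_drop (index x ys) ys)
        (drop_nth x) ?index_mem // nth_index.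
    by apply/negP => /index_ltn; rewrite ltnn.
  subst ys; have [al runE] := allowed_move_front x1 sx ays.
  by exists (ys1 ++ ys2) => //; rewrite -runE.
have [al runE] := run_topple_notin xys sx ays.
exists ys => //; rewrite runE /=.
by apply: leq_trans kys _; rewrite leq_addr.
Qed.

Lemma reach_from_run V W t s xs k : allowed V W t s xs ->
  reach_from V W t s k <-> reach_from V W t (run W t s xs) k.
Proof.
move=> axs; split=> [|[ys ays kys]]; last first.
  by exists (xs ++ ys); rewrite ?run_cat // allowed_cat axs.
elim: xs s axs => [//|x xs IH] s /= /andP[sx axs] sk.
exact: IH axs (reach_from_topple sx sk).
Qed.

(* [Active 0 < Sleeping < Active 1 < Active 2 < ...]: this order is preserved by
   toppling, so that waking up particles can only increase what escapes. *)
Definition site_le (s s' : site_state) : bool :=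
  match s, s' with
  | Active k, Active k' => (k <= k')%N
  | Active k, Sleeping => k == 0%N
  | Sleeping, Active k => (0 < k)%N
  | Sleeping, Sleeping => true
  end.

Definition dominated (W : pred int) (t : array) (s : state) (t' : array) (s' : state) :=
  [/\ forall y, W y -> site_le (cfg s y) (cfg s' y),
      (escaped s <= escaped s')%N
    & forall y n, W y -> t y (used s y + n)%N = t' y (used s' y + n)%N].

Lemma dominated_topple V W t s t' s' x :
  dominated W t s t' s' -> can_topple V W s x ->
  can_topple V W s' x /\ dominated W t (topple W t s x) t' (topple W t' s' x).
Proof.
move=> [le_cfg le_esc eqt] sx; have /andP[Wx occ] := sx.
have := eqt x 0%N Wx; rewrite !addn0 => tx.
split.
  rewrite /can_topple Wx /=; have := le_cfg x Wx; move: occ.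
  by case: (V x); case: (cfg s x) => [[|k]|]; case: (cfg s' x) => [[|k']|].
have {}occ := can_topple_occupied sx.
split=> /=; last 2 first.
- by rewrite tx leq_add2r.
- move=> y n Wy; case: eqP => [->|_]; last exact: eqt.
  by rewrite !addSnnS; exact: eqt.
move=> y Wy; have := le_cfg y Wy; have {occ} : y == x -> ~~ is_empty (cfg s y).
  by move=> /eqP ->.
rewrite tx /apply_instruction; case: (t' x _) => [|z] /=.
  by case: (y == x) => // /(_ isT); case: (cfg s y) => [[|[|k]]|];
    case: (cfg s' y) => [[|[|k']]|].
case: (y == z); case: (y == x) => [/(_ isT)|_]; case: (cfg s y) => [[|[|k]]|] //;
    by case: (cfg s' y) => [[|[|k']]|].
Qed.

Lemma dominated_reach V W t s t' s' k : dominated W t s t' s' ->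
  reach_from V W t s k -> reach_from V W t' s' k.
Proof.
move=> dom [xs axs kxs].
suff [axs' le_esc] : allowed V W t' s' xs /\
    (escaped (run W t s xs) <= escaped (run W t' s' xs))%N.
  by exists xs => //; exact: leq_trans le_esc.
elim: xs s s' dom axs {kxs} => [|x xs IH] s s' dom /=; first by case: dom.
move=> /andP[sx axs]; have [sx' dom'] := dominated_topple dom sx.
by rewrite sx' /=; exact: IH dom' axs.
Qed.

(** * Pathwise effect of changing or deleting one entry of the array *)

Definition set_entry (t : array) (x : int) (i : nat) (v : instruction) : array :=
  fun y n => if (y == x) && (n == i) then v else t y n.

(** The later entries of [z] move down by one, so that deletion preserves an i.i.d. law. *)
Definition del_entry (t : array) (z : int) (m : nat) : array :=
  fun y n => if (y == z) && (m <= n)%N then t y n.+1 else t y n.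

(** One step of the walk driven by the instructions, for which [Sleep] is a step on the spot. *)
Definition target (z : int) (v : instruction) : int :=
  if v is Jump w then w else z.

(* Entry [(x, i)] can become the next one to be used, with at most [m] entries
   of [z] used once it has been used. *)
Definition enabled V W (t : array) c (x : int) (i : nat) (z : int) (m : nat) : Prop :=
  exists xs, [/\ allowed V W t (init_state c) xs,
    used (run W t (init_state c) xs) x = i,
    can_topple V W (run W t (init_state c) xs) x
    & (used (run W t (init_state c) xs) z + (z == x) <= m)%N].

(** The witness has used exactly the first [i] entries at [x] and at most the first [m] at [z], so
    later ones may be altered freely. *)
Lemma eq_enabled V W t t' c x i z m :
  (forall y n, ~~ ((y == x) && (i <= n)%N) -> ~~ ((y == z) && (m <= n)%N) ->
    t y n = t' y n) ->
  enabled V W t c x i z m -> enabled V W t' c x i z m.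
Proof.
move=> tt' [xs [axs ux sx uz]]; exists xs.
have [-> ->] // : run W t' (init_state c) xs = run W t (init_state c) xs /\
    allowed V W t' (init_state c) xs = allowed V W t (init_state c) xs.
apply: eq_run => y n nu; apply: tt'.
  by apply/negP => /andP[/eqP yx]; subst y; rewrite leqNgt -ux nu.
apply/negP => /andP[/eqP yz]; subst y; rewrite leqNgt => /negP; apply.
by apply: leq_trans nu _; apply: leq_trans uz; rewrite leq_addr.
Qed.

(** The counter at [x] grows by one at a time; the prefix sought ends just before the toppling that
    uses entry [i]. *)
Lemma allowed_first_use V W t s xs x i : (used s x <= i)%N ->
  allowed V W t s xs -> (i < used (run W t s xs) x)%N ->
  exists xs', [/\ allowed V W t s xs', used (run W t s xs') x = i
    & can_topple V W (run W t s xs') x].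
Proof.
move=> ui; elim/last_ind: xs => [_|xs y IH]; first by rewrite ltnNge ui.
rewrite allowed_rcons => /andP[axs sy].
have [iu _|ui' iu] := ltnP i (used (run W t s xs) x); first exact: IH.
exists xs; move: iu; rewrite run_rcons /=; case: eqP => [xy|_]; last by rewrite ltnNge ui'.
by subst y; rewrite ltnS => iu; split=> //; apply/eqP; rewrite eqn_leq ui'.
Qed.

(** A run that used the entry [(x, i)] would have a prefix witnessing [enabled] for some [m]. Hence
    no run ever reads the value put there. *)
Lemma reach_set_entry_disabled V W t c x i z a b k :
  (forall m, ~ enabled V W t c x i z m) ->
  reach V W (set_entry t x i a) c k -> reach V W (set_entry t x i b) c k.
Proof.
move=> dis [xs axs kxs].
  have [ix|xi] := ltnP i (used (run W (set_entry t x i a) (init_state c) xs) x).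
  have [ys [ays ux sx]] := allowed_first_use (leq0n i : (used (init_state c) x <= i)%N) axs ix.
  have [runE alE] : run W t (init_state c) ys = run W (set_entry t x i a) (init_state c) ys /\
      allowed V W t (init_state c) ys = allowed V W (set_entry t x i a) (init_state c) ys.
    apply: eq_run => y n nu; rewrite /set_entry; case: eqP => //= yx.
    by subst y; rewrite ltn_eqF // -ux.
  exfalso; apply: (dis _); exists ys; rewrite runE alE; split=> //.
have [runE alE] : run W (set_entry t x i b) (init_state c) xs =
      run W (set_entry t x i a) (init_state c) xs /\
    allowed V W (set_entry t x i b) (init_state c) xs =
      allowed V W (set_entry t x i a) (init_state c) xs.
  apply: eq_run => y n nu; rewrite /set_entry; case: eqP => //= yx.
  by subst y; rewrite ltn_eqF // (leq_trans nu).
by exists xs; rewrite ?runE ?alE.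
Qed.

(** The last toppling of [z] used a [Sleep], and no particle has arrived at [z] since, as it would
    have woken it up. Omitting that toppling therefore affects no other site. *)
Lemma allowed_awake V W t s xs z : allowed V W t s xs ->
  cfg s z <> Sleeping -> cfg (run W t s xs) z = Sleeping ->
  exists xs', [/\ allowed V W t s xs',
    forall y, y != z -> cfg (run W t s xs') y = cfg (run W t s xs) y,
    forall y, y != z -> used (run W t s xs') y = used (run W t s xs) y
    & (used (run W t s xs') z < used (run W t s xs) z)%N].
Proof.
move=> axs awake; elim/last_ind: xs axs => [//|xs x IH].
rewrite allowed_rcons run_rcons => /andP[axs sx] /=.
have [xz|xz] := eqVneq x z.
  subst x; case tz : (t z _) => [|w] asleep; last first.
    move: asleep; rewrite /= eqxx.
    by case: (z == w); case: (cfg _ z) => [[|]|].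
  by exists xs; split=> // y /negPf yz; rewrite /= yz.
have zx : z == x = false by rewrite eq_sym (negPf xz).
move=> asleep; have {asleep} asleep : cfg (run W t s xs) z = Sleeping.
  move: asleep; case: (t x _) => [|w] /=; rewrite zx //.
  by case: (z == w) => //; case: (cfg _ z).
have [ys [ays cfgE usedE ltu]] := IH axs asleep.
exists (rcons ys x); rewrite allowed_rcons run_rcons ays /can_topple cfgE //= usedE //.
split=> //= [y yz|y yz|]; last by rewrite zx.
  by case: (t x _) => [|w] /=; rewrite cfgE.
by rewrite usedE.
Qed.

Lemma site_le_refl a : site_le a a.
Proof. by case: a => [k|] /=. Qed.

(* Minimality of [m] is what makes [z] awake when the particle lands there:
   were it asleep, its last toppling could be omitted. Toppling [z] at that
   time is then legal, and moves a particle from [z] to [target z (t z m)]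
   without disturbing the rest. *)
Lemma reach_del_entry V (W : pred int) t c x i z m k : W z -> c z <> Sleeping ->
  enabled V W t c x i z m -> (forall m', (m' < m)%N -> ~ enabled V W t c x i z m') ->
  reach V W (set_entry t x i (Jump z)) c k ->
  reach V W (set_entry (del_entry t z m) x i (Jump (target z (t z m)))) c k.
Proof.
move=> Wz awake [xs [axs ux sx uz]] minm rz.
set s := run W t (init_state c) xs in ux sx uz.
have {}uz : (used s z + (z == x))%N = m.
  apply/eqP; rewrite eqn_leq uz leqNgt; apply/negP => /minm; apply.
  by exists xs; split.
have {}awake : z != x -> cfg s z <> Sleeping.
  move=> zx asleep.
  have [ys [ays cfgE usedE ltu]] := allowed_awake axs awake asleep.
  apply: (minm (used (run W t (init_state c) ys) z)).
    by apply: leq_trans ltu _; rewrite -uz leq_addr.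
  exists ys; split; rewrite ?(negPf zx) ?addn0 // ?usedE // 1?eq_sym //.
  by move: sx; rewrite /can_topple cfgE // eq_sym.
set t1 := set_entry t x i _ in rz *; set t2 := set_entry _ x i _.
have [run1 al1] : run W t1 (init_state c) xs = s /\ allowed V W t1 (init_state c) xs = true.
  rewrite -axs; apply: eq_run => y n nu; rewrite /t1 /set_entry; case: eqP => //= yx.
  by subst y; rewrite ltn_eqF // -ux.
have [run2 al2] : run W t2 (init_state c) xs = s /\ allowed V W t2 (init_state c) xs = true.
  rewrite -axs; apply: eq_run => y n nu; rewrite /t2 /set_entry /del_entry.
  have -> : (y == x) && (n == i) = false.
    by apply/negP => /andP[/eqP yx /eqP ni]; subst y n; move: nu; rewrite -/s ux ltnn.
  case: (eqVneq y z) => //= yz; subst y; rewrite leqNgt -uz.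
  by rewrite (leq_trans nu) // leq_addr.
have t1x : t1 x (used s x) = Jump z by rewrite /t1 /set_entry ux !eqxx.
have t2x : t2 x (used s x) = Jump (target z (t z m)) by rewrite /t2 /set_entry ux !eqxx.
(* Once the particle has landed, [z] holds [j.+1] active particles, and removing one restores what
   [z] would hold without the landing. *)
have zE : exists j, cfg (topple W t1 s x) z = Active j.+1 /\
    remove_particle (Active j.+1) = if z == x then remove_particle (wake_up (cfg s z)) else cfg s z.
  rewrite /topple t1x /= eqxx; move: awake; case: (z == x) => [_|/(_ isT)].
    by case: (cfg s z) => [j|]; eexists.
  by case: (cfg s z) => [j|//]; exists j.
have {zE} [j [zE rem_zE]] := zE.
have s1z : can_topple V W (topple W t1 s x) z.
  by rewrite /can_topple Wz zE; case: (V z).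
have t1z : t1 z (used (topple W t1 s x) z) = t z m.
  rewrite /= /t1 /set_entry; case: eqP uz => [->|_] /=; last by rewrite addn0 => ->.
  by rewrite -ux addn1 => <-; rewrite gtn_eqF.
move: rz; rewrite /reach (reach_from_run (xs := rcons xs x)); last first.
  by rewrite allowed_rcons al1 run1.
rewrite run_rcons run1 => /(reach_from_topple s1z) r1.
rewrite (reach_from_run (xs := rcons xs x)) ?allowed_rcons ?al2 ?run2 // run_rcons run2.
(* The run for [t1] has used one more entry of [z]. On [W] the configurations agree, except that a
   [Sleep] at [(z, m)] may have put the particle at [z] to sleep in the first one. *)
apply: dominated_reach r1; split.
- move=> y Wy; rewrite /= t1z t2x t1x /=.
  pose q u := if u == x then remove_particle (wake_up (cfg s u)) else cfg s u.
  have {zE rem_zE} qz : q z = Active j by rewrite /q -rem_zE /=.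
  case: (t z m) => [|w] /=; rewrite -/(q y); case: (eqVneq y z) => [->|yz];
    rewrite ?qz ?site_le_refl //.
    by case: (j) => [|j'] //=; rewrite leqnn.
- have -> : escaped (topple W t1 (topple W t1 s x) z) =
      (escaped s + jumps_out W (Jump z) + jumps_out W (t z m))%N.
    by rewrite -t1z /= t1x.
  by rewrite /= t2x Wz addn0 leq_add2l; case: (t z m).
move=> y n _ /=; rewrite /t1 /t2 /set_entry /del_entry.
case: (eqVneq y x) => [yx|yx] /=.
  subst y; rewrite ux; case: (eqVneq x z) => [xz|xz] /=.
    subst z; rewrite -uz ux eqxx addn1 leq_addr !gtn_eqF //= ?addSn // ltnS.
      by rewrite leq_addr.
    by rewrite ltnW // ltnS leq_addr.
  by rewrite gtn_eqF // ltnS leq_addr.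
case: (eqVneq y z) => [yz|//] /=; subst y.
by rewrite -uz (negPf yx) addn0 leq_addr addSn.
Qed.

Lemma reach_set_entry_trap V (W C : pred int) t c x i v o k :
  (forall y, C y -> W y) -> (forall y n, C y -> C (target y (t y n))) ->
  C v || (~~ C x && ~~ W v) -> ~~ W o ->
  reach V W (set_entry t x i (Jump v)) c k -> reach V W (set_entry t x i (Jump o)) c k.
Proof.
move=> CW Ct Cv Wo [xs axs kxs].
set t1 := set_entry t x i (Jump v) in axs kxs *; set t2 := set_entry t x i (Jump o).
pose sim s s' := [/\ forall y, W y -> ~~ C y -> cfg s y = cfg s' y,
  forall y, ~~ C y -> used s y = used s' y & (escaped s <= escaped s')%N].
suff simP s s' : sim s s' -> allowed V W t1 s xs ->
    allowed V W t2 s' [seq y <- xs | ~~ C y] /\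
    (escaped (run W t1 s xs) <= escaped (run W t2 s' [seq y <- xs | ~~ C y]))%N.
  have [] // := simP (init_state c) (init_state c) _ axs.
  by move=> al le_esc; exists [seq y <- xs | ~~ C y] => //; exact: leq_trans le_esc.
elim: xs s s' {axs kxs} => [|y xs IH] s s' /=; first by case.
move=> [cfgE usedE le_esc] /andP[sy axs]; have /andP[Wy _] := sy.
have neqC u w : ~~ C u -> C w -> (u == w) = false.
  by move=> Cu Cw; apply: contraNF Cu => /eqP ->.
have neqW u w : W u -> ~~ W w -> (u == w) = false.
  by move=> Wu Ww; apply: contraNF Ww => /eqP <-.
have [Cy|Cy] /= := boolP (C y).
  apply: IH axs; have : C (target y (t1 y (used s y))).
    rewrite /t1 /set_entry; case: ifP => [/andP[/eqP yx _]|_]; last exact: Ct.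
    by move: Cv; rewrite -yx Cy orbF.
  case t1y: (t1 y _) => [|w] /= Cw; split=> /= [u Wu Cu|u Cu|];
    rewrite ?t1y /= ?(neqC u y) ?(neqC u w) ?addn0 ?(CW _ Cw) //; auto.
  by rewrite addn0.
have -> /= : can_topple V W s' y by move: sy; rewrite /can_topple cfgE.
apply: IH axs; split=> /= [u Wu Cu|u Cu|]; last 2 first.
- by rewrite usedE.
- rewrite -usedE // /t1 /t2 /set_entry.
  by case: ifP => _ /=; rewrite leq_add // ?Wo ?leq_b1.
rewrite -usedE // /t1 /t2 /set_entry.
case: ifP => _ /=.
  rewrite (neqW u o) // cfgE //; have -> // : (u == v) = false.
  by move: Cv => /orP[|/andP[_]]; [exact: neqC|exact: neqW].
by case: (t y _) => [|w] /=; rewrite cfgE.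
Qed.

Definition kill (V : pred int) (o : int) (v : instruction) : instruction :=
  if v is Jump w then if V w then v else Jump o else v.

(** With killed instructions [W] outside [V] stays empty, so only sites of [V] get toppled, and a
    jump out of [W] is exactly a jump that leaves [V] under [t]. The same sequence serves on both
    sides. *)
Lemma reach_kill (V W : pred int) t t' c o k :
  (forall y, V y -> W y) -> ~~ W o -> (forall y, ~~ V y -> is_empty (c y)) ->
  (forall y n, V y -> t' y n = kill V o (t y n)) ->
  reach V W t' c k -> reach V V t c k.
Proof.
move=> VW Wo c0 tE [xs axs kxs].
have Vo : ~~ V o by apply: contra Wo; exact: VW.
pose sim s s' := [/\ forall y, V y -> cfg s y = cfg s' y,
  forall y, W y -> ~~ V y -> is_empty (cfg s y), used s = used s' & escaped s = escaped s'].
suff simP s s' : sim s s' -> allowed V W t' s xs ->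
    allowed V V t s' xs /\ escaped (run W t' s xs) = escaped (run V t s' xs).
  have [|al esc] := simP (init_state c) (init_state c) _ axs.
    by split=> //= y _; exact: c0.
  by exists xs; rewrite -?esc.
elim: xs s s' {axs kxs} => [|y xs IH] s s' /=; first by case.
move=> [cfgE cfg0 usedE escE] /andP[sy axs]; have /andP[Wy] := sy.
case: ifPn => Vy; last by rewrite cfg0.
move=> act; rewrite {1}/can_topple Vy -cfgE // act /=; apply: IH axs.
rewrite /topple usedE escE tE //; split=> //=.
- move=> u Vu; rewrite /kill; case: (t y _) => [|w] /=; first by rewrite cfgE.
  case: ifPn => Vw /=; rewrite cfgE //.
  have -> : (u == o) = false by apply: contraNF Vo => /eqP <-.
  by have -> : (u == w) = false by apply: contraNF Vw => /eqP <-.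
- move=> u Wu Vu; have uy : (u == y) = false by apply: contraNF Vu => /eqP ->.
  rewrite /kill; case: (t y _) => [|w] /=; first by rewrite uy cfg0.
  case: ifPn => Vw /=; rewrite uy.
    have -> : (u == w) = false by apply: contraNF Vu => /eqP ->.
    exact: cfg0.
  have -> : (u == o) = false by apply: contraNF Wo => /eqP <-.
  exact: cfg0.
congr (_ + nat_of_bool _)%N; rewrite /kill; case: (t y _) => [//|w] /=.
by case: ifPn => Vw /=; rewrite ?Wo ?(VW _ Vw).
Qed.

(** * Measurable events on the space of arrays *)

Definition instruction_code (v : instruction) : option int :=
  if v is Jump w then Some w else None.
Definition instruction_decode (o : option int) : instruction :=
  if o is Some w then Jump w else Sleep.
Lemma instruction_codeK : cancel instruction_code instruction_decode.
Proof. by case. Qed.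
HB.instance Definition _ := Countable.copy instruction (can_type instruction_codeK).
HB.instance Definition _ := isPointed.Build instruction Sleep.

(** The pi-system generating the product sigma-algebra on arrays. *)
Definition cylinders : set (set array) :=
  [set B | exists (r : seq (int * nat)) (A : int * nat -> set instruction),
    B = [set t | forall e, e \in r -> A e (t e.1 e.2)]].

Definition array_space := g_sigma_algebraType cylinders.

Lemma measurable_cylinder (e : int * nat) (A : set instruction) :
  measurable ([set t | A (t e.1 e.2)] : set array_space).
Proof.
apply: sub_sigma_algebra; exists [:: e], (fun=> A).
apply/seteqP; split=> t /= At; last exact: At (mem_head _ _).
by move=> e'; rewrite inE => /eqP ->.
Qed.

Lemma setI_closed_cylinders : setI_closed cylinders.
Proof.
move=> _ _ [r1 [A1 ->]] [r2 [A2 ->]]; exists (r1 ++ r2).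
exists (fun e => [set v | (e \in r1 -> A1 e v) /\ (e \in r2 -> A2 e v)]).
apply/seteqP; split=> t /=.
  by move=> [t1 t2] e _; split; [exact: t1|exact: t2].
move=> t12; split=> e er; have := t12 e; rewrite mem_cat er ?orbT.
  by move=> /(_ isT)[+ _]; apply.
by move=> /(_ isT)[_ +]; apply.
Qed.

(** Fixing the value of one entry removes it from [F]; there are countably many instructions, so [B]
    is a countable union of such slices. *)
Lemma measurable_finite_dependence (F : seq (int * nat)) (B : set array) :
  (forall t t' : array, (forall e, e \in F -> t e.1 e.2 = t' e.1 e.2) -> B t -> B t') ->
  measurable (B : set array_space).
Proof.
elim: F B => [|e F IH] B BF.
  have [->|/set0P[t Bt]] := eqVneq B set0; first exact: measurable0.
  rewrite (_ : B = setT); first exact: measurableT.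
  by apply/seteqP; split=> // t' _; exact: BF Bt.
pose Bv v := [set t : array | t e.1 e.2 = v] `&` [set t | B (set_entry t e.1 e.2 v)].
have setK (t : array) : set_entry t e.1 e.2 (t e.1 e.2) = t.
  apply/funext => y; apply/funext => n; rewrite /set_entry.
  by case: ifP => // /andP[/eqP -> /eqP ->].
rewrite (_ : B = \bigcup_v Bv v); last first.
  apply/seteqP; split=> t /=.
    by move=> Bt; exists (t e.1 e.2) => //; split=> //=; rewrite setK.
  by move=> [v _ [/= <-]]; rewrite setK.
apply: countable_bigcupT_measurable; first exact: countableP.
move=> v; apply: measurableI; first exact: (measurable_cylinder e [set v]).
apply: IH => t t' tt' /=; apply: BF => e'; rewrite inE /set_entry.
case: ifP => // ne /orP[/eqP e'e|]; last exact: tt'.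
by move: ne; rewrite e'e !eqxx.
Qed.

(** The sequence [xs] uses at most [size xs] entries at each of its sites and none elsewhere. The
    condition on [f] carries this finite dependence from [f t] back to [t]. *)
Lemma measurable_run_event V W c (f : array -> array) (xs : seq int) (Q : state -> Prop) :
  (forall (t t' : array) y n, (forall n', (n' <= n)%N -> t y n' = t' y n') ->
    f t y n = f t' y n) ->
  measurable ([set t | allowed V W (f t) (init_state c) xs /\
    Q (run W (f t) (init_state c) xs)] : set array_space).
Proof.
move=> fE; apply: (@measurable_finite_dependence
  [seq (y, n) | y <- xs, n <- iota 0 (size xs)]) => t t' tt' /=.
suff [-> ->] : run W (f t') (init_state c) xs = run W (f t) (init_state c) xs /\
  allowed V W (f t') (init_state c) xs = allowed V W (f t) (init_state c) xs by [].
apply: eq_run => y n nu; apply: fE => n' n'n; apply: (tt' (y, n')).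
apply/allpairsP; exists (y, n'); split=> //=; last first.
  by rewrite mem_iota /= add0n (leq_ltn_trans n'n) // (leq_trans nu) // used_run_size.
apply: contraLR nu; rewrite -leqNgt => yxs.
suff -> : used (run W (f t) (init_state c) xs) y = 0%N by [].
have : used (init_state c) y = 0%N by [].
elim: xs (init_state c) yxs {tt'} => [//|x xs IH] s; rewrite inE negb_or => /andP[yx yxs] u0.
by apply: IH => //=; rewrite (negPf yx).
Qed.

Lemma measurable_run_exists V W c (f : array -> array) (Q : state -> Prop) :
  (forall (t t' : array) y n, (forall n', (n' <= n)%N -> t y n' = t' y n') ->
    f t y n = f t' y n) ->
  measurable ([set t | exists xs, allowed V W (f t) (init_state c) xs /\
    Q (run W (f t) (init_state c) xs)] : set array_space).
Proof.
move=> fE; rewrite (_ : mkset _ = \bigcup_(xs in [set: seq int])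
    [set t | allowed V W (f t) (init_state c) xs /\ Q (run W (f t) (init_state c) xs)]).
  apply: countable_bigcupT_measurable; first exact: countableP.
  by move=> xs; exact: measurable_run_event.
by apply/seteqP; split=> t /= [xs]; [move=> ?; exists xs|move=> _ ?; exists xs].
Qed.

(** * Independent instructions: total probability and deletion of an entry *)

Lemma measure_seq_partition (R : realType) (d : measure_display) (T : measurableType d)
    (Pr : probability T R) (f : T -> instruction) (r : seq instruction) (A : set T) :
  (forall B : set instruction, measurable [set w | B (f w)]) -> uniq r ->
  measurable A ->
  Pr (A `&` [set w | f w \in r]) = (\sum_(v <- r) Pr (A `&` [set w | f w = v]))%E.
Proof.
move=> mf ur mA; elim: r ur => [_|v r IH /= /andP[vr ur]].
  by rewrite big_nil (_ : mkset _ = set0) ?setI0 ?measure0 //; apply/seteqP; split.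
have mr : measurable [set w | f w \in r] by exact: (mf [set` r]).
have mv : measurable [set w | f w = v] by exact: (mf [set v]).
rewrite big_cons -IH // -measureU; last 3 first.
- exact: measurableI.
- exact: measurableI.
- by apply/seteqP; split=> w //= [[_ ->] [_ /(negP vr)]].
congr (Pr _); apply/seteqP; split=> w /=.
  by move=> [Aw]; rewrite inE => /orP[/eqP|]; [left|right].
by rewrite inE => -[[Aw ->]|[Aw ->]]; rewrite ?eqxx ?orbT.
Qed.

Lemma total_probability_seq (R : realType) (d : measure_display) (T : measurableType d)
    (Pr : probability T R) (f : T -> instruction) (r : seq instruction) (A : set T) :
  (forall B : set instruction, measurable [set w | B (f w)]) -> uniq r ->
  Pr [set w | f w \notin r] = 0%E -> measurable A ->
  Pr A = (\sum_(v <- r) Pr (A `&` [set w | f w = v]))%E.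
Proof.
move=> mf ur r0 mA; rewrite -(measure_seq_partition Pr mf ur mA).
have mr : measurable [set w | f w \in r] by exact: (mf [set` r]).
rewrite (measureDI Pr mA mr) (@subset_measure0 _ _ _ _ _ _ _ _ _ r0) ?add0e //.
- exact: measurableD.
- by have := measurableC mr; congr measurable; apply/seteqP; split=> w /= /negP.
- by move=> w /= [_ /negP].
Qed.

(** Laws may differ between sites, which keeps this class stable when the instructions of some sites
    are altered. The finite lists [S y] turn averages over an instruction into finite sums. *)
Definition iid_array (R : realType) (d : measure_display) (T : measurableType d)
    (Pr : probability T R) (S : int -> seq instruction) (tau : T -> array) : Prop :=
  [/\ forall y n (A : set instruction), measurable [set w | A (tau w y n)],
      forall (r : seq (int * nat)) (A : int * nat -> set instruction), uniq r ->
        Pr [set w | forall e, e \in r -> A e (tau w e.1 e.2)] =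
        (\prod_(e <- r) Pr [set w | A e (tau w e.1 e.2)])%E,
      forall y n (A : set instruction),
        Pr [set w | A (tau w y n)] = Pr [set w | A (tau w y 0%N)]
    & forall y, uniq (S y) /\ forall n, Pr [set w | tau w y n \notin S y] = 0%E].

Section iid.
Variables (R : realType) (d : measure_display) (T : measurableType d).
Variables (Pr : probability T R) (S : int -> seq instruction) (tau : T -> array).
Hypothesis tau_iid : iid_array Pr S tau.

Lemma iid_measurable (B : set array) :
  measurable (B : set array_space) -> measurable [set w | B (tau w)].
Proof.
have [mtau _ _ _] := tau_iid.
apply: (@smallest_sub _ _ _ [set B : set array | measurable [set w | B (tau w)]]).
  split=> /= [|B' mB'|F mF].
  - exact: measurable0.
  - rewrite [X in measurable X](_ : _ = ~` [set w | B' (tau w)]); first exact: measurableC.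
    by apply/seteqP; split=> w //= -[].
  - rewrite (_ : mkset _ = \bigcup_n [set w | F n (tau w)]) //.
    exact: bigcupT_measurable.
move=> _ [r [A ->]] /=.
rewrite (_ : mkset _ = \bigcap_(e in [set` r]) [set w | A e (tau w e.1 e.2)]) //.
by apply: fin_bigcap_measurable => // e _; exact: mtau.
Qed.

Lemma iid_measurable_entry y n (A : set instruction) :
  measurable [set w | A (tau w y n)].
Proof. by have [mtau _ _ _] := tau_iid; exact: mtau. Qed.

Lemma total_probability y n (A : set T) : measurable A ->
  Pr A = (\sum_(v <- S y) Pr (A `&` [set w | tau w y n = v]))%E.
Proof.
move=> mA; have [_ _ _ /(_ y)[uS /(_ n) S0]] := tau_iid.
exact: (total_probability_seq (iid_measurable_entry y n) uS S0 mA).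
Qed.

Lemma sum_entry_law y n : (\sum_(v <- S y) Pr [set w | tau w y n = v] = 1)%E.
Proof.
rewrite -(probability_setT Pr) (total_probability y n measurableT).
by apply: eq_bigr => v _; rewrite setTI.
Qed.

(** On cylinders this is independence together with equality of laws along a site, since deletion
    reindexes the entries injectively and avoids [(z, m)]. A Dynkin class argument extends it to all
    measurable sets. *)
Lemma iid_del_entry z m (A : set instruction) (B : set array) :
  measurable (B : set array_space) ->
  measurable [set w | A (tau w z m) /\ B (del_entry (tau w) z m)] /\
  Pr [set w | A (tau w z m) /\ B (del_entry (tau w) z m)] =
  (Pr [set w | A (tau w z m)] * Pr [set w | B (tau w)])%E.
Proof.
have [mtau indep ident _] := tau_iid.
(* [shift e] is the place in the original array of entry [e] of the reduced one. *)
pose shift (e : int * nat) := (e.1, if (e.1 == z) && (m <= e.2)%N then e.2.+1 else e.2).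
have delE t (e : int * nat) : del_entry t z m e.1 e.2 = t (shift e).1 (shift e).2.
  by rewrite /del_entry /shift /=; case: ifP.
have shift_inj : injective shift.
  move=> [y n] [y' n'] [<-]; case: eqP => //= _; last by move=> ->.
  case: (leqP m n) => mn; case: (leqP m n') => mn' nn'.
  - by case: nn' => ->.
  - by move: mn'; rewrite -nn' ltnNge (leq_trans mn).
  - by move: mn; rewrite nn' ltnNge (leq_trans mn').
  - by rewrite nn'.
have zm_shift e : shift e != (z, m).
  apply/negP => /eqP[]; case: e => y n /= ->; rewrite eqxx /=.
  by case: (leqP m n) => mn nm; move: mn; rewrite -nm ?ltnn.
pose AB (B : set array) := [set w | A (tau w z m) /\ B (del_entry (tau w) z m)].
pose H : set (set array) := [set B | [/\ measurable [set w | B (tau w)],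
  measurable (AB B) & Pr (AB B) = (Pr [set w | A (tau w z m)] * Pr [set w | B (tau w)])%E]].
suff HB : (measurable : set (set array_space)) `<=` H by move=> /HB[].
have fA : Pr [set w | A (tau w z m)] \is a fin_num by exact: fin_num_measure.
apply: (@lambda_system_subset _ cylinders setI_closed_cylinders setT H) => //.
- split=> //.
  + have ABT : AB setT = [set w | A (tau w z m)] by apply/seteqP; split=> w //= -[].
    have TT : [set w | [set: array] (tau w)] = setT by [].
    rewrite /H /= ABT TT probability_setT mule1; split=> //; exact: mtau.
  + move=> B1 B2 sub [m1 mA1 E1] [m2 mA2 E2].
    have dE : [set w | (B1 `\` B2) (tau w)] = [set w | B1 (tau w)] `\` [set w | B2 (tau w)] by [].
    have dA : AB (B1 `\` B2) = AB B1 `\` AB B2.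
      apply/seteqP; split=> w /=; first by move=> [Aw [w1 w2]]; split=> // -[_ /w2].
      by move=> [[Aw w1] w2]; split=> //; split=> // ?; apply: w2.
    split; rewrite ?dE ?dA; [exact: measurableD|exact: measurableD|].
    rewrite !measureD ?ltey_eq ?fin_num_measure //.
    rewrite !setIidr ?E1 ?E2; [|by move=> w /= /sub|by move=> w /= [? /sub]].
    by rewrite muleBr ?fin_num_adde_defr ?fin_num_measure //; congr (_ - _)%E.
  + move=> F ndF HF; split.
    * rewrite (_ : mkset _ = \bigcup_n [set w | F n (tau w)]) //.
      by apply: bigcupT_measurable => n; have [] := HF n.
    * rewrite (_ : AB _ = \bigcup_n AB (F n)).
        by apply: bigcupT_measurable => n; have [] := HF n.
      by apply/seteqP; split=> w [] => [Aw [n _ Fn]|n _ [Aw Fn]]; [exists n|split=> //; exists n].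
    have cvgA : Pr (AB (F n)) @[n --> \oo] --> Pr (\bigcup_n AB (F n)).
      apply: nondecreasing_cvg_mu => [n||n n' nn'].
      - by have [] := HF n.
      - by apply: bigcupT_measurable => n; have [] := HF n.
      - by apply/subsetPset => w [Aw Fw]; split=> //; move/subsetPset: (ndF _ _ nn'); exact.
    have cvgB : Pr [set w | F n (tau w)] @[n --> \oo] --> Pr (\bigcup_n [set w | F n (tau w)]).
      apply: nondecreasing_cvg_mu => [n||n n' nn'].
      - by have [] := HF n.
      - by apply: bigcupT_measurable => n; have [] := HF n.
      - by apply/subsetPset => w Fw; move/subsetPset: (ndF _ _ nn'); exact.
    rewrite (_ : AB _ = \bigcup_n AB (F n)); last first.
      by apply/seteqP; split=> w [] => [Aw [n _ Fn]|n _ [Aw Fn]]; [exists n|split=> //; exists n].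
    apply: (cvg_unique _ cvgA) => //.
    rewrite (_ : (fun n => Pr (AB (F n))) =
      (fun n => Pr [set w | A (tau w z m)] * Pr [set w | F n (tau w)])%E).
      exact: cvgeZl.
    by apply/funext => n; have [] := HF n.
- move=> _ [r0 [A' ->]]; pose r := undup r0.
  (* Each constraint is carried to the entry it reads. Quantifying over the preimages [e'] avoids an
     explicit inverse of [shift]. *)
  have cylE : AB [set t | forall e, e \in r0 -> A' e (t e.1 e.2)] =
      [set w | forall e, e \in (z, m) :: map shift r ->
        [set v | (e = (z, m) -> A v) /\ forall e', shift e' = e -> A' e' v] (tau w e.1 e.2)].
    apply/seteqP; split=> w /=.
      move=> [Aw Aw'] e; rewrite inE => /orP[/eqP ->|/mapP[e' e'r ->]]; split=> //=.
      - by move=> e' /eqP; rewrite (negPf (zm_shift e')).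
      - by move/eqP; rewrite (negPf (zm_shift e')).
      - move=> e'' /shift_inj ->; rewrite -delE; apply: Aw'.
        by rewrite -mem_undup.
    move=> Aw; split; first by have [Azm _] := Aw (z, m) (mem_head _ _); exact: Azm.
    move=> e er; rewrite delE; have [|_ Ae] := Aw (shift e); last exact: Ae.
    by rewrite inE map_f ?orbT // mem_undup.
  have BE : [set w | forall e, e \in r0 -> A' e (tau w e.1 e.2)] =
      [set w | forall e, e \in r -> A' e (tau w e.1 e.2)].
    by apply/seteqP; split=> w Aw e; rewrite ?mem_undup => er; apply: Aw; rewrite ?mem_undup.
  have mcyl (r1 : seq (int * nat)) (A1 : int * nat -> set instruction) :
      measurable [set w | forall e, e \in r1 -> A1 e (tau w e.1 e.2)].
    apply: (@iid_measurable [set t | forall e, e \in r1 -> A1 e (t e.1 e.2)]).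
    by apply: sub_sigma_algebra; exists r1, A1.
  split; first exact: mcyl.
    rewrite cylE; exact: (mcyl _ (fun e => [set v | (e = (z, m) -> A v) /\
      forall e', shift e' = e -> A' e' v])).
  rewrite cylE BE (indep ((z, m) :: map shift r) (fun e => [set v | (e = (z, m) -> A v) /\
    forall e', shift e' = e -> A' e' v])); last first.
    rewrite /= map_inj_uniq // undup_uniq andbT.
    by apply/mapP => -[e _] /esym/eqP; rewrite (negPf (zm_shift e)).
  rewrite indep ?undup_uniq // big_cons big_map; congr (_ * _)%E.
    congr (Pr _); apply/seteqP; split=> w /=; first by move=> [+ _]; exact.
    by move=> Aw; split=> // e' /eqP; rewrite (negPf (zm_shift e')).
  apply: eq_bigr => e _.
  rewrite (ident _ (shift e).2) [in RHS](ident _ e.2) /=.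
  congr (Pr _); apply/seteqP; split=> w /=; first by move=> [_]; exact.
  move=> Aw; split=> [/eqP|e' /shift_inj -> //].
  by rewrite (negPf (zm_shift e)).
Qed.

End iid.

(** * Redirecting jumps in one entry to [o] *)

(* The entries that are changed are the late ones, so that the entries at [x]
   still unused once [(x, j.-1)] has been used all have the same law. *)
Definition rewrite_from (x : int) (j : nat) (g : instruction -> instruction)
    (t : array) : array :=
  fun y n => if (y == x) && (j <= n)%N then g (t y n) else t y n.

(** A deletion at or after the threshold moves no entry across it. *)
Lemma rewrite_from_del x i g t z m : (z == x -> i <= m)%N ->
  rewrite_from x i g (del_entry t z m) = del_entry (rewrite_from x i g t) z m.
Proof.
move=> im; apply/funext => y; apply/funext => n; rewrite /rewrite_from /del_entry.
case: (eqVneq y z) => [yz|//]; subst y; case: (leqP m n) => mn; rewrite ?andbF //=.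
case: eqP im => //= _ /(_ isT) im.
by rewrite (leq_trans im mn) (leq_trans im (leqW mn)).
Qed.

Lemma enabled_gt V W t c x i m : enabled V W t c x i x m -> (i < m)%N.
Proof. by move=> [xs [_ <- _]]; rewrite eqxx addn1. Qed.

Section one_entry.
Variables (R : realType) (d : measure_display) (T : measurableType d).
Variables (Pr : probability T R) (S : int -> seq instruction) (tau : T -> array).
Hypothesis tau_iid : iid_array Pr S tau.
Variables (V W : pred int) (ws : seq int) (c : config) (o x : int) (i k : nat).
Variable g : instruction -> instruction.
Hypothesis W_ws : forall y, W y -> y \in ws.
Hypothesis c_awake : forall y, c y <> Sleeping.
Hypothesis Wo : ~~ W o.
Hypothesis gE : forall v, g v = v \/ (exists y, v = Jump y) /\ g v = Jump o.

Let t_ := rewrite_from x i.+1 g.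

Let B y : set array := [set t | reach V W (set_entry (t_ t) x i (Jump y)) c k].

Let mB y : measurable (B y : set array_space).
Proof.
have := @measurable_run_exists V W c (fun t => set_entry (t_ t) x i (Jump y))
  (fun s => (k <= escaped s)%N).
rewrite (_ : mkset _ = B y) => [|]; first apply => t t' z n tt'.
  by rewrite /t_ /set_entry /rewrite_from tt'.
by apply/seteqP; split=> t /= [xs]; [move=> []|]; exists xs.
Qed.

Let first_enabled z m : set array :=
  [set t | enabled V W (t_ t) c x i z m /\
    forall m', (m' < m)%N -> ~ enabled V W (t_ t) c x i z m'].

Let mfirst_enabled z m : measurable (first_enabled z m : set array_space).
Proof.
pose E m : set array_space := [set t | enabled V W (t_ t) c x i z m].
have mE m' : measurable (E m').
  have := @measurable_run_exists V W c t_
    (fun s => [/\ used s x = i, can_topple V W s x & (used s z + (z == x) <= m')%N]).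
  rewrite (_ : mkset _ = E m'); first by apply=> t t' y n tt'; rewrite /t_ /rewrite_from tt'.
  by apply/seteqP; split=> t [xs]; [move=> [? []]|move=> []]; exists xs.
rewrite (_ : first_enabled z m = E m `&` \bigcap_(m' in `I_m) ~` E m').
  apply: measurableI => //; apply: bigcap_measurableType => m' _.
  exact: measurableC.
by apply/seteqP; split=> t.
Qed.

(** As for a stopping time, the value [m] is decided before the entry [(z, m)] is read. *)
Let first_enabled_del z m t : first_enabled z m t -> first_enabled z m (del_entry t z m).
Proof.
move=> [en nen]; have im : (z == x -> i < m)%N.
  by move=> /eqP zx; subst z; exact: enabled_gt en.
have tE : t_ (del_entry t z m) = del_entry (t_ t) z m by exact: rewrite_from_del.
split; rewrite tE.
  apply: eq_enabled en => y n _ zn; rewrite /del_entry.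
  by case: ifP => //; rewrite (negPf zn).
move=> m' m'm en'; apply: (nen _ m'm); apply: eq_enabled en' => y n _ zn.
rewrite /del_entry; case: ifP => // /andP[yz mn]; move: zn; rewrite yz /=.
by rewrite (leq_trans (ltnW m'm) mn).
Qed.

(** The instruction in force at the entry [(z, m)]: for [z = x], that entry comes after [(x, i)] and
    is already rewritten. *)
Let gz z (v : instruction) := if z == x then g v else v.

Let entry_step z m t : W z -> first_enabled z m t -> B z t ->
  B (target z (gz z (t z m))) (del_entry t z m).
Proof.
move=> Wz [en nen] Bt; have im : (z == x -> i < m)%N.
  by move=> /eqP zx; subst z; exact: enabled_gt en.
have := reach_del_entry Wz (c_awake (y := z)) en nen Bt.
rewrite /B /= /t_ rewrite_from_del //; congr (reach _ _ (set_entry _ _ _ (Jump (target _ _))) _ _).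
by rewrite /gz /rewrite_from; case: eqP im => //= _ /(_ isT) ->.
Qed.

Let never_enabled z : set array := [set t | forall m, ~ enabled V W (t_ t) c x i z m].

Let stage z m : set array := if m is m'.+1 then first_enabled z m' else never_enabled z.

Let stage_cover z t : exists m, stage z m t.
Proof.
have [[m en]|nen] := pselect (exists m, enabled V W (t_ t) c x i z m); last first.
  by exists 0%N => m en; apply: nen; exists m.
have [m' [/asboolP en' min]] := @ex_minnP _
  (ex_intro (fun m => `[< enabled V W (t_ t) c x i z m >]) m (asboolT en)).
exists m'.+1; split=> // m2 m2m' en2.
by have := min m2 (asboolT en2); rewrite leqNgt m2m'.
Qed.

Let stage_trivIset z : trivIset setT (fun m => [set w | stage z m (tau w)]).
Proof.
apply/trivIsetP => -[|m1] [|m2] _ _ m12; apply/seteqP; split=> w //=.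
- by move=> [nen [en _]]; exact: nen en.
- by move=> [[en _] nen]; exact: nen en.
- move=> [[en1 nen1] [en2 nen2]]; have [m12'|m21|m12'] := ltngtP m1 m2.
  + exact: nen2 en1.
  + exact: nen1 en2.
  + by move: m12; rewrite m12' eqxx.
Qed.

Let mnever z : measurable (never_enabled z : set array_space).
Proof.
rewrite (_ : never_enabled z = ~` \bigcup_m first_enabled z m).
  by apply: measurableC; apply: bigcupT_measurable => m; exact: mfirst_enabled.
apply/seteqP; split=> t /=; first by move=> nen [m _ [en _]]; exact: nen en.
move=> nfirst m en; have [[|m'] st] := stage_cover z t; first exact: st en.
by apply: nfirst; exists m'.
Qed.

Let mstage z m : measurable (stage z m : set array_space).
Proof. by case: m => [|m]; [exact: mnever|exact: mfirst_enabled]. Qed.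

Let stage_sum z (A : set array) : measurable (A : set array_space) ->
  (Pr [set w | A (tau w)] = \sum_(m <oo) Pr [set w | (A `&` stage z m) (tau w)])%E.
Proof.
move=> mA; have mAs m : measurable [set w | (A `&` stage z m) (tau w)].
  by apply: (iid_measurable tau_iid); apply: measurableI => //; exact: mstage.
rewrite (_ : [set w | A (tau w)] = \bigcup_m [set w | (A `&` stage z m) (tau w)]).
  rewrite measure_semi_bigcup //; last exact: bigcupT_measurable.
  apply/trivIsetP => m1 m2 _ _ m12; apply/seteqP; split=> w //= [[_ s1] [_ s2]].
  have /trivIsetP/(_ m1 m2 Logic.I Logic.I m12) := @stage_trivIset z.
  by move=> /seteqP[+ _] => /(_ w); apply; split.
apply/seteqP; split=> w /= => [Aw|[m _ []//]].
by have [m sm] := stage_cover z (tau w); exists m.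
Qed.

Let u y := Pr [set w | B y (tau w)].

(** Both sides are split along the partition [stage z] and compared stage by stage. *)
Let subharmonic z : W z ->
  (u z <= \sum_(v <- S z) Pr [set w | tau w z 0%N = v] * u (target z (gz z v)))%E.
Proof.
move=> Wz; rewrite /u (stage_sum z (@mB z)).
under [leRHS]eq_bigr do rewrite (stage_sum z (@mB _)).
have pE v : Pr [set w | tau w z 0%N = v] = (fine (Pr [set w | tau w z 0%N = v]))%:E.
  by rewrite fineK // fin_num_measure //; exact: (iid_measurable_entry tau_iid z 0%N [set v]).
under [leRHS]eq_bigr => v _.
  rewrite pE -nneseriesZl; last by move=> m _; exact: measure_ge0.
  over.
rewrite -nneseries_sum; last by move=> v m _; rewrite -pE mule_ge0.
apply: lee_nneseries => m _ //; under [leRHS]eq_bigr do rewrite -pE.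
have mBs y m' : measurable ((B y `&` stage z m') : set array_space) by exact: measurableI.
have [_ _ ident _] := tau_iid.
case: m => [|m].
  (* Here the entry [(x, i)] is never reached, so the landing site makes no difference and the
     weights sum to one. *)
  rewrite [leRHS](_ : _ = (\sum_(v <- S z) Pr [set w | tau w z 0%N = v]) *
      Pr [set w | (B z `&` stage z 0%N) (tau w)])%E; last first.
    rewrite ge0_sume_distrl => [|v _]; last exact: measure_ge0.
    apply: eq_bigr => v _; congr (_ * Pr _)%E.
    by apply/seteqP; split=> w [Bw sw]; split=> //; move: Bw;
      apply: reach_set_entry_disabled => m; exact: sw.
  by rewrite (sum_entry_law tau_iid) mul1e.
(* Conditioning on the entry [(z, m)]: by [entry_step] the event passes to the array without it,
   which is independent of it and has the original law. *)
rewrite (total_probability tau_iid z m (iid_measurable tau_iid (mBs z m.+1))).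
apply: lee_sum => v _; have := iid_del_entry tau_iid z m [set v] (mBs (target z (gz z v)) m.+1).
rewrite /= (ident z m [set v]) /= => -[mdel <-].
apply: le_measure; rewrite ?inE //.
- apply: measurableI; first exact: (iid_measurable tau_iid (mBs z m.+1)).
  exact: (iid_measurable_entry tau_iid z m [set v]).
- move=> w /= [[Bw sw] <-]; split=> //; split; first exact: entry_step.
  exact: first_enabled_del.
Qed.

Let fine_u y : u y = (fine (u y))%:E.
Proof. by rewrite fineK // fin_num_measure //; exact: (iid_measurable tau_iid (@mB y)). Qed.

Let outside y : ~~ W y -> (u y <= u o)%E.
Proof.
move=> Wy; apply: le_measure; rewrite ?inE; [exact: (iid_measurable tau_iid (@mB y))|
  exact: (iid_measurable tau_iid (@mB o))|move=> w].
by apply: (@reach_set_entry_trap _ _ pred0); rewrite //= Wy.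
Qed.

(* Maximum principle: a maximum of [u] above [u o] would be attained on a set
   of sites that no instruction leaves, where an additional particle is
   worthless. *)
Let u_le y0 : (u y0 <= u o)%E.
Proof.
rewrite leNgt; apply/negP => uo; have [Wy0|/outside] := boolP (W y0); last first.
  by rewrite leNgt uo.
(* A maximum over [W] is found by induction along [ws], starting from [y0]; listed sites outside [W]
   are skipped. *)
have [z [Wz zmax]] : exists z, W z /\ forall y, W y -> (u y <= u z)%E.
  suff : forall r : seq int,
      exists z, W z /\ forall y, W y -> y \in y0 :: r -> (u y <= u z)%E.
    move=> /(_ ws)[z [Wz zmax]]; exists z; split=> // y Wy.
    by apply: zmax; rewrite // inE W_ws ?orbT.
  elim=> [|y r [z [Wz zr]]]; first by exists y0; split=> // y _; rewrite inE => /eqP ->.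
  have [Wy|Wy] := boolP (W y); last first.
    exists z; split=> // y' Wy'; rewrite !inE => /or3P[y'y0|/eqP y'y|y'r].
    - by apply: zr; rewrite // inE y'y0.
    - by move: Wy; rewrite -y'y Wy'.
    - by apply: zr; rewrite // inE y'r orbT.
  have [yz|zy] := leP (u y) (u z).
    exists z; split=> // y' Wy'; rewrite !inE => /or3P[y'y0|/eqP -> //|y'r].
    - by apply: zr; rewrite // inE y'y0.
    - by apply: zr; rewrite // inE y'r orbT.
  exists y; split=> // y' Wy'; rewrite !inE => /or3P[y'y0|/eqP -> //|y'r];
    apply: le_trans (ltW zy); apply: zr; rewrite // inE ?y'y0 // y'r orbT //.
have uz : (u o < u z)%E by apply: lt_le_trans uo (zmax _ Wy0).
pose C y := W y && (u y == u z).
have u_max y : (u y <= u z)%E.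
  have [/zmax//|/outside Wy] := boolP (W y).
  exact: le_trans Wy (ltW uz).
have u_lt y : ~~ C y -> (u y < u z)%E.
  rewrite /C negb_and => /orP[/outside Wy|yz]; first exact: le_lt_trans Wy uz.
  by rewrite lt_neqAle yz u_max.
(* Subharmonicity at a maximum makes a sum of nonnegative terms at most zero. Each term vanishes,
   and a target outside [C] has strictly smaller [u], so its weight is zero. *)
have C_stable y v : C y -> v \in S y -> ~~ C (target y (gz y v)) ->
    Pr [set w | tau w y 0%N = v] = 0%E.
  move=> /andP[Wy /eqP yz] vS nC.
  pose q v' := fine (Pr [set w | tau w y 0%N = v']).
  have qE v' : Pr [set w | tau w y 0%N = v'] = (q v')%:E.
    by rewrite fineK // fin_num_measure //; exact: (iid_measurable_entry tau_iid y 0%N [set v']).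
  have q0 v' : 0 <= q v' by rewrite -lee_fin -qE.
  have q1 : \sum_(v' <- S y) q v' = 1.
    apply: EFin_inj; rewrite -sumEFin -(sum_entry_law tau_iid y 0%N).
    by apply: eq_bigr => v' _; rewrite qE.
  have := subharmonic Wy; under eq_bigr do rewrite qE fine_u -EFinM.
  rewrite sumEFin yz (fine_u z) lee_fin -[leLHS]mul1r -q1 mulr_suml -subr_le0 -sumrB => le0.
  have term_ge0 v' : 0 <= q v' * fine (u z) - q v' * fine (u (target y (gz y v'))).
    by rewrite -mulrBr mulr_ge0 // subr_ge0 -lee_fin -!fine_u.
  have /eqP := le_anti (introT andP (conj le0 (sumr_ge0 _ (fun v' _ => term_ge0 v')))).
  rewrite psumr_eq0 // => /allP/(_ v vS)/=; rewrite -mulrBr mulf_eq0 subr_eq0 => /orP[/eqP qv|].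
    by rewrite qE qv.
  by move: (u_lt _ nC); rewrite (fine_u z) (fine_u (target _ _)) lte_fin => /gt_eqF ->.
(* The instruction at [e] leads out of [C]. These null events are countably many and are discarded
   together in [N]. *)
pose esc e := [set w | C e.1 /\ ~~ C (target e.1 (gz e.1 (tau w e.1 e.2)))].
have mesc (e : int * nat) : measurable (esc e).
  exact: (iid_measurable_entry tau_iid e.1 e.2
    [set v | C e.1 /\ ~~ C (target e.1 (gz e.1 v))]).
have esc0 (e : int * nat) : Pr (esc e) = 0%E.
  rewrite (total_probability tau_iid e.1 e.2 (mesc e)) big_seq big1 // => v vS.
  have mv : measurable [set w | tau w e.1 e.2 = v].
    exact: (iid_measurable_entry tau_iid e.1 e.2 [set v]).
  have [[Ce nC]|CC] := pselect (C e.1 /\ ~~ C (target e.1 (gz e.1 v))).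
    apply: (@subset_measure0 _ _ _ _ _ [set w | tau w e.1 e.2 = v]) => //.
      exact: measurableI.
    have [_ _ ident _] := tau_iid; have := ident e.1 e.2 [set v].
    by rewrite /= => ->; exact: C_stable.
  rewrite (_ : _ `&` _ = set0) ?measure0 //.
  by apply/seteqP; split=> w //= -[+ wv]; rewrite /esc /= wv.
pose N := \bigcup_e esc e.
have mN : measurable N.
  by apply: countable_bigcupT_measurable => //; exact: countableP.
have N0 : Pr N = 0%E.
  pose F n := if unpickle n is Some e then esc e else set0.
  have : Pr.-negligible (\bigcup_n F n).
    apply: negligible_bigcup => n; rewrite /F; case: (unpickle n) => [e|].
      by apply/negligibleP; [exact: mesc|exact: esc0].
    exact: negligible_set0.
  rewrite (_ : \bigcup_n F n = N); first by move=> /(negligibleP _ mN).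
  apply/seteqP; split=> w [].
    by move=> n _; rewrite /F; case: (unpickle n) => [e ?|//]; exists e.
  by move=> e _ we; exists (pickle e) => //; rewrite /F pickleK.
have Cz : C z by rewrite /C Wz eqxx.
suff : (u z <= u o)%E by rewrite leNgt uz.
have mBo := iid_measurable tau_iid (@mB o).
rewrite -[leRHS](measureU0 mBo mN N0).
apply: le_measure; rewrite ?inE; [exact: (iid_measurable tau_iid (@mB z))|exact: measurableU|].
move=> w Bz; have [Nw|Nw] := pselect (N w); [by right|left].
apply: (@reach_set_entry_trap V W C (t_ (tau w)) c x i z o k); rewrite ?Cz //.
  by move=> y /andP[].
move=> y n Cy; have Cyn : C (target y (gz y (tau w y n))).
  by apply/negPn/negP => nC; apply: Nw; exists (y, n).
(* At [x] the entries up to [i] are not rewritten, whereas stability was shown for rewritten ones. A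
   changed instruction would be [Jump o], which leaves [C]; so [g] changes none of them. *)
move: Cyn; rewrite /gz /t_ /rewrite_from; case: eqP => //= _; case: ifP => // _.
have [->//|[_ ->]] := gE (tau w y n).
by move=> /andP[]; rewrite /= (negPf Wo).
Qed.

Let Be v : set array := [set t | reach V W (set_entry (t_ t) x i v) c k].

(* [Be v'] does not depend on the entry [(x, i)]; it is expressed through
   [del_entry] to deduce independence from [iid_del_entry]. *)
Let indep_entry v v' :
  measurable [set w | tau w x i = v /\ Be v' (tau w)] /\
  Pr [set w | tau w x i = v /\ Be v' (tau w)] =
  (Pr [set w | tau w x i = v] * Pr [set w | Be v' (tau w)])%E.
Proof.
(* [ins] reopens a slot at [(x, i)]; whatever it holds is overwritten in [Be]. *)
pose ins (t : array) : array := fun y n => if (y == x) && (i < n)%N then t y n.-1 else t y n.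
pose B' : set array := [set t | Be v' (ins t)].
have insK t : Be v' (ins (del_entry t x i)) = Be v' t.
  rewrite /Be /=; congr (reach _ _ _ _ _); apply/funext => y; apply/funext => n.
  rewrite /set_entry /t_ /rewrite_from /ins /del_entry; case: eqP => //= ->.
  case: (ltngtP i n) => [iN|ni|//] //=.
  by case: n iN => // n; rewrite ltnS /= => ->.
have mB' : measurable (B' : set array_space).
  have := @measurable_run_exists V W c (fun t => set_entry (t_ (ins t)) x i v')
    (fun s => (k <= escaped s)%N).
  rewrite (_ : mkset _ = B') => [|]; first apply => t t' z n tt'.
    by rewrite /t_ /set_entry /rewrite_from /ins !tt' // leq_pred.
  by apply/seteqP; split=> t /= [xs]; [move=> []|]; exists xs.
have [mA EA] := iid_del_entry tau_iid x i [set v] mB'.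
(* With no condition on the deleted entry, this identifies the probability of [B'] with that of
   [Be v']. *)
have [_ ET] := iid_del_entry tau_iid x i setT mB'.
have TE : [set w | [set: instruction] (tau w x i) /\ B' (del_entry (tau w) x i)] =
    [set w | Be v' (tau w)].
  by apply/seteqP; split=> w /=; rewrite /B' /= insK => // -[].
have AE : [set w | [set v] (tau w x i) /\ B' (del_entry (tau w) x i)] =
    [set w | tau w x i = v /\ Be v' (tau w)].
  by apply/seteqP; split=> w /=; rewrite /B' /= insK.
move: ET; rewrite TE (_ : [set w | setT (tau w x i)] = setT) // probability_setT mul1e => ->.
by rewrite -AE.
Qed.

(** The two arrays differ only at [(x, i)], whose value is independent of the rest. Given that
    value, either nothing changes or [Jump y] becomes [Jump o], and [u_le] applies. *)
Lemma reach_rewrite_from_step :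
  (Pr [set w | reach V W (rewrite_from x i.+1 g (tau w)) c k] <=
   Pr [set w | reach V W (rewrite_from x i g (tau w)) c k])%E.
Proof.
have m_ j : measurable [set w | reach V W (rewrite_from x j g (tau w)) c k].
  apply: (iid_measurable tau_iid (B := [set t | reach V W (rewrite_from x j g t) c k])).
  have := @measurable_run_exists V W c (rewrite_from x j g) (fun s => (k <= escaped s)%N).
  rewrite (_ : mkset _ = [set t | reach V W (rewrite_from x j g t) c k]) => [|].
    by apply => t t' z n tt'; rewrite /rewrite_from tt'.
  by apply/seteqP; split=> t /= [xs]; [move=> []|]; exists xs.
have E1 t : rewrite_from x i.+1 g t = set_entry (t_ t) x i (t x i).
  apply/funext => y; apply/funext => n; rewrite /set_entry /t_ /rewrite_from.
  case: eqP => //= ->; case: eqP => //= ->.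
  by rewrite ltnn.
have E0 t : rewrite_from x i g t = set_entry (t_ t) x i (g (t x i)).
  apply/funext => y; apply/funext => n; rewrite /set_entry /t_ /rewrite_from.
  by case: eqP => //= ->; case: ltngtP => //= ->.
rewrite (total_probability tau_iid x i (m_ i.+1)) (total_probability tau_iid x i (m_ i)).
apply: lee_sum => v _.
rewrite (_ : _ `&` _ = [set w | tau w x i = v /\ Be v (tau w)]); last first.
  by apply/seteqP; split=> w /= [] => [+ wv|wv]; rewrite E1 wv.
rewrite [in leRHS](_ : _ `&` _ = [set w | tau w x i = v /\ Be (g v) (tau w)]); last first.
  by apply/seteqP; split=> w /= [] => [+ wv|wv]; rewrite E0 wv.
rewrite !(indep_entry _ _).2; apply: lee_wpmul2l => //.
by have [->|[[y ->] ->]] := gE v; [exact: lexx|exact: u_le].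
Qed.

End one_entry.

(** * From one entry to whole sites, one site after another *)

Lemma iid_map (R : realType) (d : measure_display) (T : measurableType d)
    (Pr : probability T R) S (tau : T -> array) (f : int -> instruction -> instruction) :
  iid_array Pr S tau ->
  iid_array Pr (fun y => undup (map (f y) (S y))) (fun w y n => f y (tau w y n)).
Proof.
move=> [mtau indep ident S0]; split.
- by move=> y n A; exact: (mtau y n (f y @^-1` A)).
- by move=> r A ur; exact: (indep r (fun e => f e.1 @^-1` A e) ur).
- by move=> y n A; exact: (ident y n (f y @^-1` A)).
move=> y; split=> [|n]; first exact: undup_uniq.
apply: (@subset_measure0 _ _ _ _ _ _ _ _ _ ((S0 y).2 n)).
- exact: (mtau y n [set v | f y v \notin undup (map (f y) (S y))]).
- exact: (mtau y n [set v | v \notin S y]).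
by move=> w /=; apply: contra => vS; rewrite mem_undup map_f.
Qed.

Lemma measurable_reach (R : realType) (d : measure_display) (T : measurableType d)
    (Pr : probability T R) S (tau : T -> array) (V W : pred int) c k (f : array -> array) :
  iid_array Pr S tau ->
  (forall (t t' : array) y n, (forall n', (n' <= n)%N -> t y n' = t' y n') ->
    f t y n = f t' y n) ->
  measurable [set w | reach V W (f (tau w)) c k].
Proof.
move=> tau_iid fE; apply: (iid_measurable tau_iid (B := [set t | reach V W (f t) c k])).
have := @measurable_run_exists V W c f (fun s => (k <= escaped s)%N) fE.
rewrite (_ : mkset _ = [set t | reach V W (f t) c k]) //.
by apply/seteqP; split=> t /= [xs]; [move=> []|]; exists xs.
Qed.

(** A run using at most [N] entries at [x] does not see a rewriting from [N] on, and finitely many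
    single-entry steps lower [N] to [0]. Such runs exhaust the event as [N] grows. *)
Lemma reach_rewrite_site (R : realType) (d : measure_display) (T : measurableType d)
    (Pr : probability T R) S (tau : T -> array) (V W : pred int) (ws : seq int)
    (c : config) (o x : int) (k : nat) (g : instruction -> instruction) :
  iid_array Pr S tau -> (forall y, W y -> y \in ws) -> (forall y, c y <> Sleeping) ->
  ~~ W o -> (forall v, g v = v \/ (exists y, v = Jump y) /\ g v = Jump o) ->
  (Pr [set w | reach V W (tau w) c k] <=
   Pr [set w | reach V W (rewrite_from x 0 g (tau w)) c k])%E.
Proof.
move=> tau_iid W_ws c_awake Wo gE.
have step i : (Pr [set w | reach V W (rewrite_from x i g (tau w)) c k] <=
    Pr [set w | reach V W (rewrite_from x 0 g (tau w)) c k])%E.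
  elim: i => [|i]; first exact: lexx.
  move=> IH; apply: le_trans IH.
  exact: (reach_rewrite_from_step tau_iid V x i k W_ws c_awake Wo gE).
pose E N : set T := [set w | exists xs, allowed V W (tau w) (init_state c) xs /\
  (fun s => (k <= escaped s)%N /\ (used s x <= N)%N) (run W (tau w) (init_state c) xs)].
have mE N : measurable (E N).
  apply: (iid_measurable tau_iid (B := [set t | exists xs,
    allowed V W t (init_state c) xs /\
    (fun s => (k <= escaped s)%N /\ (used s x <= N)%N) (run W t (init_state c) xs)])).
  apply: (@measurable_run_exists V W c id
    (fun s => (k <= escaped s)%N /\ (used s x <= N)%N)) => t t' z n tt'.
  exact: tt'.
have EE : \bigcup_N E N = [set w | reach V W (tau w) c k].
  apply/seteqP; split=> w /=; first by move=> [N _ [xs [axs [kxs _]]]]; exists xs.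
  by move=> [xs axs kxs]; exists (used (run W (tau w) (init_state c) xs) x) => //; exists xs.
have cvgE : Pr (E N) @[N --> \oo] --> Pr (\bigcup_N E N).
  apply: nondecreasing_cvg_mu => // [|N N' NN']; first exact: bigcupT_measurable.
  apply/subsetPset => w [xs [axs [kxs uN]]]; exists xs; split=> //; split=> //.
  exact: leq_trans NN'.
rewrite -EE -(cvg_lim _ cvgE) //; apply: lime_le; first by apply/cvg_ex; eexists; exact: cvgE.
apply: nearW => N; apply: le_trans (step N).
apply: le_measure; rewrite ?inE //.
  apply: (measurable_reach _ _ _ _ tau_iid) => t t' y n tt'.
  by rewrite /rewrite_from tt'.
move=> w [xs [axs [kxs uN]]].
have [runE alE] : run W (rewrite_from x N g (tau w)) (init_state c) xs =
      run W (tau w) (init_state c) xs /\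
    allowed V W (rewrite_from x N g (tau w)) (init_state c) xs =
      allowed V W (tau w) (init_state c) xs.
  apply: eq_run => y n nu; rewrite /rewrite_from; case: eqP => //= yx; subst y.
  by rewrite leqNgt (leq_trans nu).
by exists xs; rewrite ?alE ?runE.
Qed.

Lemma kill_id V o v : ~~ V o -> kill V o (kill V o v) = kill V o v.
Proof. by case: v => [//|w] Vo /=; case: ifPn => Vw /=; rewrite ?Vw // (negPf Vo). Qed.

Definition kill_on (V : pred int) (o : int) (L : seq int) (t : array) : array :=
  fun y n => if y \in L then kill V o (t y n) else t y n.

(** Idempotence of [kill] covers an [x] already occurring in [L]. *)
Lemma kill_on_cons V o x L t : ~~ V o ->
  kill_on V o (x :: L) t = rewrite_from x 0 (kill V o) (kill_on V o L t).
Proof.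
move=> Vo; apply/funext => y; apply/funext => n.
rewrite /kill_on /rewrite_from inE andbT; case: eqP => //= _.
by case: ifP => // _; rewrite kill_id.
Qed.

Lemma reach_kill_on (R : realType) (d : measure_display) (T : measurableType d)
    (Pr : probability T R) S (tau : T -> array) (V W : pred int) (ws L : seq int)
    (c : config) (o : int) (k : nat) :
  iid_array Pr S tau -> (forall y, W y -> y \in ws) -> (forall y, c y <> Sleeping) ->
  ~~ V o -> ~~ W o ->
  (Pr [set w | reach V W (tau w) c k] <=
   Pr [set w | reach V W (kill_on V o L (tau w)) c k])%E.
Proof.
move=> tau_iid W_ws c_awake Vo Wo; elim: L => [|x L IH]; first exact: lexx.
apply: le_trans IH _; under [in leRHS]eq_set do rewrite kill_on_cons //.
(* Killing at the earlier sites leaves an array of the same class, to which the one-site comparison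
   applies again. *)
have kill_iid : iid_array Pr _ (fun w => kill_on V o L (tau w)) :=
  iid_map (fun y v => if y \in L then kill V o v else v) tau_iid.
apply: (@reach_rewrite_site _ _ _ _ _ _ V W ws c o x k (kill V o) kill_iid) => // -[|w] /=.
  by left.
by case: ifP => _; [left|right; split=> //; exists w].
Qed.

(** * The law of the model and the domination *)

Lemma nearest_neighbour_sum (R : realType) (P : int -> int -> R) x :
  jump_distribution P -> nearest_neighbour P -> P x (x - 1) + P x (x + 1) = 1.
Proof.
move=> [P01 P1] Pnn; apply: EFin_inj; rewrite -(P1 x).
have neq : x - 1 != x + 1 by rewrite (inj_eq (addrI x)).
rewrite (esumID [set` [:: x - 1; x + 1]]); last first.
  by move=> y _; rewrite lee_fin; have /andP[] := P01 x y.
rewrite !setTI esum_fset; last 2 first.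
- exact: finite_seq.
- by move=> y _; rewrite lee_fin; have /andP[] := P01 x y.
rewrite -fsbig_seq /= ?inE ?neq // big_cons big_seq1 esum1 ?adde0 // => y /= yx.
rewrite Pnn //; apply/negP => /eqP xy; apply: yx; rewrite !inE.
have /orP[/eqP d|/eqP d] : (x - y == 1) || (x - y == -1).
  by move/eqP: xy; rewrite eqr_norml => /andP[].
  by rewrite -d subKr eqxx.
have -> : y = x + 1 by rewrite -[LHS](subKr x) d opprK.
by rewrite eqxx orbT.
Qed.

(** [Sleep] and the two nearest-neighbour jumps already have total mass one, so the law at each site
    is carried by three atoms whose weights do not depend on the index. *)
Lemma iid_instruction_array (R : realType) (d : measure_display) (T : measurableType d)
    (Pr : probability T R) (lambda : R) (P : int -> int -> R)
    (tau : int -> nat -> T -> instruction) :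
  0 < lambda -> jump_distribution P -> nearest_neighbour P ->
  instruction_array Pr lambda P tau ->
  iid_array Pr (fun y => [:: Sleep; Jump (y - 1); Jump (y + 1)])
    (fun w y n => tau y n w).
Proof.
move=> lambda0 P_distr P_nn [mtau indep tau_sleep tau_jump].
pose S y := [:: Sleep; Jump (y - 1); Jump (y + 1)].
have uS y : uniq (S y).
  have neq : y - 1 != y + 1 by rewrite (inj_eq (addrI y)).
  rewrite /S /= !inE /= andbT; apply/negP => /eqP[] /eqP.
  by rewrite (negPf neq).
have S1 y n : Pr [set w | tau y n w \in S y] = 1%E.
  have := measure_seq_partition Pr (mtau y n) (uS y) (@measurableT _ T).
  rewrite setTI => ->; rewrite !big_cons big_nil adde0 !setTI.
  have := tau_sleep y n; rewrite /preimage /= => ->.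
  have := tau_jump y n (y - 1); rewrite /preimage /= => ->.
  have := tau_jump y n (y + 1); rewrite /preimage /= => ->.
  rewrite -!EFinD -mulrDl nearest_neighbour_sum // -mulrDl addrC divff //.
  by rewrite gt_eqF // addr_gt0.
have S0 y n : Pr [set w | tau y n w \notin S y] = 0%E.
  have mS : measurable [set w | tau y n w \in S y] by exact: (mtau y n [set` S y]).
  rewrite (_ : mkset _ = ~` [set w | tau y n w \in S y]).
    by rewrite probability_setC // S1 subee.
  by apply/seteqP; split=> w /= /negP.
split=> [y n A|r A ur|y n A|y].
- exact: (mtau y n A).
- exact: (indep r A ur).
- have mA m : measurable [set w | A (tau y m w)] by exact: (mtau y m A).
  rewrite (total_probability_seq (mtau y n) (uS y) (S0 y n) (mA n)).
  rewrite (total_probability_seq (mtau y 0%N) (uS y) (S0 y 0%N) (mA 0%N)).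
  apply: eq_bigr => v _; have [Av|nAv] := pselect (A v); last first.
    by congr (Pr _); apply/seteqP; split=> w //= [+ wv]; rewrite wv.
  have vE m : [set w | A (tau y m w)] `&` [set w | tau y m w = v] = tau y m @^-1` [set v].
    by apply/seteqP; split=> w /= [] // ->.
  by rewrite !vE; case: v {Av vE} => [|z]; rewrite ?tau_sleep ?tau_jump.
- by split=> [|n]; [exact: uS|exact: S0].
Qed.

Lemma int_segment_seq a b y : int_segment a b y ->
  y \in [seq a + i%:Z | i <- iota 0 `|b - a|%N.+1].
Proof.
move=> /andP[ay yb]; apply/mapP; exists `|y - a|%N.
  by rewrite mem_iota /= add0n ltnS -lez_nat !gez0_abs ?subr_ge0 ?lerD2r // (le_trans ay).
by rewrite gez0_abs ?subr_ge0 // subrKC.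
Qed.

Theorem lemma3 (R : realType) (lambda : R) (lambda_gt0 : 0 < lambda)
    (P : int -> int -> R) (P_distr : jump_distribution P)
    (P_nn : nearest_neighbour P)
    (n : nat) (n_ge1 : (1 <= n)%N) (eta : int -> nat)
    (a b : int) (subW : forall x, box n x -> int_segment a b x)
    (d : measure_display) (T : measurableType d) (Pr : probability T R)
    (tau : int -> nat -> T -> instruction)
    (tau_arr : instruction_array Pr lambda P tau) :
  let eta0 := active_config (box n) eta in
  let M (w : T) : \bar R :=
    num_escaped R (box n) (box n) (fun x i => tau x i w) eta0 in
  let MW (w : T) : \bar R :=
    num_escaped R (box n) (int_segment a b) (fun x i => tau x i w) eta0 in
  forall k : nat,
    (Pr [set w | k%:R%:E <= MW w] <= Pr [set w | k%:R%:E <= M w])%E.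
Proof.
move=> eta0 M MW k; have tau_iid := iid_instruction_array lambda_gt0 P_distr P_nn tau_arr.
pose t (w : T) : array := fun x i => tau x i w.
have reachE W : [set w | (k%:R%:E <= num_escaped R (box n) W (t w) eta0)%E] =
    [set w | reach (box n) W (t w) eta0 k].
  by apply/seteqP; split=> w /=; apply num_escapedP.
rewrite [X in (Pr X <= _)%E](reachE (int_segment a b)) [X in (_ <= Pr X)%E](reachE (box n)).
(* The site [b + 1] serves as [o]. *)
have Wo : ~~ int_segment a b (b + 1).
  by rewrite /int_segment negb_and -!ltNge ltrDl ltr01 orbT.
have Vo : ~~ box n (b + 1) by apply: contra Wo; exact: subW.
pose ws := [seq a + i%:Z | i <- iota 0 `|b - a|%N.+1].
apply: le_trans (reach_kill_on ws k tau_iid (@int_segment_seq a b) _ Vo Wo) _.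
  by move=> y; rewrite /eta0 /active_config; case: ifP.
(* Once the jumps out of the box are killed at every site of [W], the comparison is an inclusion of
   events. *)
apply: le_measure; rewrite ?inE.
- apply: (measurable_reach _ _ _ _ tau_iid) => t1 t2 y i t12.
  by rewrite /kill_on t12.
- by apply: (measurable_reach _ _ _ _ (f := id) tau_iid) => t1 t2 y i; apply.
move=> w; apply: (reach_kill (o := b + 1) subW Wo) => y.
  by rewrite /eta0 /active_config => /negPf ->.
by move=> i /subW/int_segment_seq Wy; rewrite /kill_on Wy.
Qed.
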